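(* Assume the Green's functions $G_D[2T]$, $G_D[T]$, $G_{M_2}[T]$ exist. Let $\sigma_1,\sigma_2\in L^1(I)$, let $u_{M_2}$ be the unique solution of $Lu=\sigma_1$ a.e. on $I$, $u\in X_{M_2,T}$, and $u_D$ the unique solution of $Lu=\sigma_2$ a.e. on $I$, $u\in X_{D,T}$. Then: 1. If $G_D[2T]\ge0$ on $J\times J$ and $|\sigma_2(t)|\le\sigma_1(t)$ for a.e. $t\in I$, then $|u_D(t)|\le u_{M_2}(t)$ for all $t\in I$. 2. If $G_D[2T]\le0$ on $J\times J$ and $0\le\sigma_2(t)\le\sigma_1(t)$ for a.e. $t\in I$, then $u_{M_2}(t)\le0$ and $u_{M_2}(t)\le u_D(t)$ for all $t\in I$. 3. If $G_D[2T]\le0$ on $J\times J$ and $\sigma_1(t)\le\sigma_2(t)\le0$ for a.e. $t\in I$, then $u_{M_2}(t)\ge0$ and $u_D(t)\le u_{M_2}(t)$ for all $t\in I$.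
   Context: Fix $n\ge 1$, $T>0$, $I=[0,T]$, $J=[0,2T]$. $W^{2n,1}(K)$: $u\in C^{2n-1}(K)$ with $u^{(2n-1)}$ absolutely continuous. Let $a_0,\dots,a_{2n-1}\in L^\alpha(I)$, $\alpha\ge1$, $Lu=u^{(2n)}+\sum_{k=0}^{2n-1}a_ku^{(k)}$ on $I$. $\widetilde L u=u^{(2n)}+\sum_{k=0}^{n-1}(\hat a_{2k+1}u^{(2k+1)}+\tilde a_{2k}u^{(2k)})$ on $J$, where $\tilde a_{2k}=a_{2k}$, $\hat a_{2k+1}=a_{2k+1}$ on $I$, and $\tilde a_{2k}(t)=a_{2k}(2T-t)$, $\hat a_{2k+1}(t)=-a_{2k+1}(2T-t)$ for $t\in(T,2T]$. An operator $M$ is nonresonant in $X$ if $Mu=0$ a.e., $u\in X$ forces $u\equiv0$; its Green's function $G$ then gives the unique solution $u(t)=\int G(t,s)\sigma(s)ds$ of $Mu=\sigma$, $u\in X$. $X_{D,T}=\{u\in W^{2n,1}(I): u^{(2k)}(0)=u^{(2k)}(T)=0,\ k=0,\dots,n-1\}$ and $X_{M_2,T}=\{u\in W^{2n,1}(I): u^{(2k)}(0)=u^{(2k+1)}(T)=0,\ k=0,\dots,n-1\}$; $G_D[T]$, $G_{M_2}[T]$ are the Green's functions of $L$ on these spaces. $G_D[2T]$: Green's function of $\widetilde L$ on $\{u\in W^{2n,1}(J): u^{(2k)}(0)=u^{(2k)}(2T)=0,\ k=0,\dots,n-1\}$. *)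

(* Defs.v *)
From HB Require Import structures.
From mathcomp Require Import all_boot all_order all_algebra.
From mathcomp Require Import all_classical all_reals all_analysis.
Set Implicit Arguments. Unset Strict Implicit. Unset Printing Implicit Defensive.
Import Order.TTheory GRing.Theory Num.Theory.
Import numFieldNormedType.Exports.
Local Open Scope classical_set_scope.
Local Open Scope ring_scope.

Section Defs.
Variable R : realType.
Notation mu := (@lebesgue_measure R).

Definition abs_cont_on (a b : R) (f : R -> R) : Prop :=
  forall eps : R, 0 < eps -> exists2 delta : R, 0 < delta &
    forall (N : nat) (l r : nat -> R),
      (forall i, (i < N)%N -> a <= l i /\ l i <= r i /\ r i <= b) ->
      (forall i j, (i < N)%N -> (j < N)%N -> i != j -> r i <= l j \/ r j <= l i) ->
      \sum_(i < N) (r i - l i) < delta ->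
      \sum_(i < N) `|f (r i) - f (l i)| < eps.

Definition deriv_within (K : set R) (f : R -> R) (t l : R) : Prop :=
  (fun s => (f s - f t) / (s - t)) @ within (K `\ t) (nbhs t) --> l.

(** D is the tower of derivatives D 0 = u, ..., D (m-1) = u^(m-1) of u on [a,b],
    witnessing u \in W^{m,1}([a,b]) : u \in C^{m-1}([a,b]) and u^(m-1) abs. continuous *)
Definition W_tower (m : nat) (a b : R) (u : R -> R) (D : nat -> R -> R) : Prop :=
  (forall t, `[a, b]%classic t -> D 0%N t = u t) /\
  (forall k, (k <= m.-1)%N -> {within `[a, b]%classic, continuous (D k)}) /\
  (forall k t, (k < m.-1)%N -> `[a, b]%classic t -> deriv_within `[a, b]%classic (D k) t (D k.+1 t)) /\
  abs_cont_on a b (D m.-1).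

Definition solves (m : nat) (a b : R) (c : nat -> R -> R)
    (bc : (nat -> R -> R) -> Prop) (sigma u : R -> R) : Prop :=
  exists D : nat -> R -> R, W_tower m a b u D /\ bc D /\
    {ae mu, forall t, `]a, b[%classic t ->
       derivable (D m.-1) t 1 /\
       derive1 (D m.-1) t + \sum_(k < m) c k t * D k t = sigma t}.

Definition nonresonant (m : nat) (a b : R) (c : nat -> R -> R)
    (bc : (nat -> R -> R) -> Prop) : Prop :=
  forall u, solves m a b c bc (fun=> 0) u -> forall t, `[a, b]%classic t -> u t = 0.

Definition is_green (m : nat) (a b : R) (c : nat -> R -> R)
    (bc : (nat -> R -> R) -> Prop) (G : R -> R -> R) : Prop :=
  nonresonant m a b c bc /\
  forall sigma : R -> R, mu.-integrable `[a, b]%classic (EFin \o sigma) ->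
    (forall t, `[a, b]%classic t -> mu.-integrable `[a, b]%classic (fun s => (G t s * sigma s)%:E)) /\
    solves m a b c bc sigma (fun t => Rintegral mu `[a, b]%classic (fun s => G t s * sigma s)).

Definition bc_D (n : nat) (a b : R) (D : nat -> R -> R) : Prop :=
  forall k, (k < n)%N -> D k.*2 a = 0 /\ D k.*2 b = 0.
Definition bc_M2 (n : nat) (a b : R) (D : nat -> R -> R) : Prop :=
  forall k, (k < n)%N -> D k.*2 a = 0 /\ D k.*2.+1 b = 0.

Definition in_Lp (p : \bar R) (D : set R) (f : R -> R) : Prop :=
  measurable_fun D f /\
  match p with
  | r%:E => (\int[mu]_(x in D) (`|f x| `^ r)%:E < +oo)%E
  | +oo%E => exists M : R, {ae mu, forall x, D x -> `|f x| <= M}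
  | -oo%E => False
  end.

Definition refl_coef (T : R) (a : nat -> R -> R) (k : nat) (t : R) : R :=
  if t <= T then a k t
  else if odd k then - a k (2 * T - t) else a k (2 * T - t).

End Defs.

(* Main.v *)
(** Let v1 be the even extension of uM2 about T and v2 the odd extension of uD.
    The boundary conditions at T make the derivatives of both match there, so v1
    and v2 solve the reflected equation on [0, 2T], with Dirichlet conditions and
    with right-hand sides the even extension of sigma1 and the odd extension of
    sigma2.  Each of the three hypotheses on sigma1 and sigma2 says that
    |sigma2| <= e' * sigma1 for a sign e', so both e' * v1 + v2 and e' * v1 - v2
    have a nonnegative right-hand side; by nonresonance they are the corresponding
    Green's integrals, so they take the sign of GD2T.  On [0, T] this bounds |uD|
    by uM2 up to a sign. *)
Require Import Defs.
From HB Require Import structures.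
From mathcomp Require Import all_boot all_order all_algebra.
From mathcomp Require Import all_classical all_reals all_analysis.
From mathcomp Require Import measurable_realfun.
From mathcomp Require Import ring lra.
Set Implicit Arguments. Unset Strict Implicit. Unset Printing Implicit Defensive.
Import Order.TTheory GRing.Theory Num.Theory.
Import numFieldNormedType.Exports.
Local Open Scope classical_set_scope.
Local Open Scope ring_scope.

(** * Invariance of Lebesgue measure under reflections of the line *)

Section Reflection.
Context {R : realType}.
Notation mu := (@lebesgue_measure R).

Definition refl (c t : R) : R := c - t.

Lemma reflK (c : R) : involutive (refl c).
Proof. by move=> t; rewrite /refl; ring. Qed.

Lemma continuous_refl (c : R) : continuous (refl c).
Proof. by move=> t; apply: cvgB; [exact: cvg_cst | exact: cvg_id]. Qed.

Lemma measurable_refl (c : R) :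
  measurable_fun setT (refl c : measurableTypeR R -> measurableTypeR R).
Proof. exact: measurable_funB. Qed.

Lemma lebesgue_measure_refl_itv (c a b : R) :
  mu (refl c @^-1` `]a, b]%classic) = mu `]a, b]%classic.
Proof.
have -> : refl c @^-1` `]a, b]%classic = `[c - b, c - a[%classic.
  apply/seteqP; split => x /=; rewrite /refl !in_itv/= => /andP[*];
    by apply/andP; split; lra.
rewrite !lebesgue_measure_itv/= !lte_fin ltrD2l ltrN2; case: ifP => // _.
by congr (_%:E); ring.
Qed.

(** Lebesgue measure is determined by its values on half-open intervals. Reflection moves the closed
    end of such an interval to the other side but keeps its length. *)
Lemma lebesgue_measure_refl (c : R) (A : set R) : measurable A ->
  pushforward mu (refl c : measurableTypeR R -> measurableTypeR R) A = mu A.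
Proof.
pose phi := refl c : measurableTypeR R -> measurableTypeR R.
pose F := isMeasurableFun.Build _ _ _ _ _ (measurable_refl c).
pose phi_pack : {mfun _ >-> _} := HB.pack phi F.
move=> mA; apply/esym.
apply: (@lebesgue_measure_unique R (pushforward mu phi_pack)) => //=.
move=> _ [[a b]] _ <-.
exact/esym/lebesgue_measure_refl_itv.
Qed.

Lemma ae_refl (c : R) (P : R -> Prop) :
  {ae mu, forall t, P t} -> {ae mu, forall t, P (refl c t)}.
Proof.
move=> [A [mA A0 PA]]; exists (refl c @^-1` A); split.
- by have := measurable_refl c measurableT mA; rewrite setTI.
- exact: etrans (lebesgue_measure_refl c mA) A0.
- by move=> t /= nP; exact: PA.
Qed.

(** Since reflection preserves [mu], the change of variables leaves the integral of the absolute
    value unchanged. *)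
Lemma integrable_refl (c : R) (f : R -> \bar R) :
  mu.-integrable setT f -> mu.-integrable setT (f \o refl c).
Proof.
move=> /integrableP[mf fi]; apply/integrableP; split.
  by apply: measurableT_comp => //; exact: measurable_refl.
have := @ge0_integral_pushforward _ _ (measurableTypeR R) (measurableTypeR R) R
  _ (measurable_refl c) mu setT (fun x => `|f x|%E) measurableT.
rewrite preimage_setT /= => <-; first rewrite (eq_measure_integral mu) //.
- exact: measurable_refl.
- by move=> ? A mA _; exact: lebesgue_measure_refl.
- exact: measurableT_comp.
- by [].
Qed.

(** The even extension about [T] is the case [c = 1], the odd one [c = -1]. The value at [T] comes
    from the left branch, so the two branches glue only when [f T = c * f T]. *)
Definition refl_ext (T c : R) (f : R -> R) (t : R) : R :=
  if t <= T then f t else c * f (refl (2 * T) t).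

Lemma refl_ext_left (T c : R) f t : t <= T -> refl_ext T c f t = f t.
Proof. by rewrite /refl_ext => ->. Qed.

Lemma refl_ext_right (T c : R) f t : f T = c * f T -> T <= t ->
  refl_ext T c f t = c * f (refl (2 * T) t).
Proof.
rewrite /refl_ext => fT; rewrite le_eqVlt => /predU1P[<-|].
  by rewrite lexx fT; congr (_ * f _); rewrite /refl; ring.
by rewrite ltNge => /negbTE ->.
Qed.

Lemma integrable_refl_ext (T c : R) (f : R -> R) :
  mu.-integrable `[0, T]%classic (EFin \o f) ->
  mu.-integrable `[0, 2 * T]%classic (EFin \o refl_ext T c f).
Proof.
move=> fi.
(* The half-open interval keeps the two restrictions from overlapping at [T]. *)
have fi' : mu.-integrable `[0, T[%classic (EFin \o f).
  apply: integrableS fi => //.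
  by move=> x /=; rewrite !in_itv/= => /andP[-> /ltW].
move: fi; rewrite integrable_mkcond// => fi.
move: fi'; rewrite integrable_mkcond// => /(integrable_refl (2 * T)) fi'.
(* On [[0, 2 * T]] the extension is the zero extension of [f] plus [c] times a reflected zero
   extension, both integrable on the whole line. *)
have h := integrableD measurableT fi (integrableZl measurableT c fi').
suff : mu.-integrable `[0, 2 * T]%classic (fun t => ((EFin \o f) \_ `[0%R, T]) t +
    c%:E * ((EFin \o f) \_ `[0%R, T[ \o refl (2 * T)) t)%E; last exact: integrableS h.
apply: eq_integrable => //.
move=> t; rewrite inE /= in_itv/= => /andP[t0 t2].
rewrite /refl_ext /patch !mem_setE !in_itv/= t0 /refl.
case: (leP t T) => tT.
  by rewrite ifF ?mule0 ?adde0//; apply/negbTE; rewrite negb_and -!leNgt; lra.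
by rewrite add0e ifT //; lra.
Qed.

(** * Gluing limits and derivatives across [T] *)

Lemma cvg_withinU {T U : topologicalType} (F : set_system T) {FF : Filter F}
    (A B : set T) (f : T -> U) (l : U) :
  f @ within A F --> l -> f @ within B F --> l -> f @ within (A `|` B) F --> l.
Proof.
move=> fA fB V lV.
have FA : F [set x | A x -> V (f x)] := fA V lV.
have FB : F [set x | B x -> V (f x)] := fB V lV.
by apply: filterS2 FA FB => x hA hB [/hA|/hB].
Qed.

(** The complement of [B] is a neighbourhood of [t] that misses [A], so the limit is vacuous. This
    settles the half of [[0, 2 * T]] that does not contain the point. *)
Lemma cvg_within_notin {T U : topologicalType} (A B : set T) (f : T -> U)
    (t : T) (l : U) : ~ B t -> closed B -> A `<=` B ->
  f @ within A (nbhs t) --> l.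
Proof.
move=> nBt cB AB V _.
by apply: filterS (open_nbhs_nbhs (conj (closed_openC cB) nBt)) => x nBx /AB.
Qed.

Lemma cvg_within_refl (c : R) {U : topologicalType} (A : set R) (f : R -> U) t
    (l : U) :
  f @ within A (nbhs (refl c t)) --> l ->
  (f \o refl c) @ within (refl c @^-1` A) (nbhs t) --> l.
Proof. by move=> fl V lV; exact: (@continuous_refl c t _ (fl V lV)). Qed.

Lemma itv_reflU (T : R) : 0 <= T ->
  `[0, 2 * T]%classic = `[0, T]%classic `|` refl (2 * T) @^-1` `[0, T]%classic.
Proof.
move=> T0; apply/seteqP; split => x /=; rewrite /refl !in_itv/=.
  move=> /andP[x0 x2]; case: (leP x T) => xT; [left|right];
    by apply/andP; split; lra.
by move=> [] /andP[? ?]; apply/andP; split; lra.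
Qed.

Lemma closed_refl_itv (c a b : R) : closed (refl c @^-1` `[a, b]%classic).
Proof.
by apply: preimage_closed => [x _|]; [exact: continuous_refl|exact: itv_closed].
Qed.

Lemma refl_ext_continuous (T c : R) (f : R -> R) : 0 <= T -> f T = c * f T ->
  {within `[0, T]%classic, continuous f} ->
  {within `[0, 2 * T]%classic, continuous (refl_ext T c f)}.
Proof.
move=> T0 fT /subspace_continuousP cf; apply/subspace_continuousP => t _.
rewrite /from_subspace in cf *; rewrite itv_reflU//; apply: cvg_withinU.
  have [It|nIt] := pselect (`[0, T]%classic t); last first.
    apply: (cvg_within_notin (B := `[0, T]%classic) _ nIt) => //.
    exact: itv_closed.
  rewrite refl_ext_left; last by move: It; rewrite /= in_itv/= => /andP[].
  apply: cvg_trans (cf _ It); apply: fmap_within_eq => s.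
  by rewrite inE /= in_itv/= => /andP[_ ?]; rewrite refl_ext_left.
have [It|nIt] := pselect (`[0, T]%classic (refl (2 * T) t)); last first.
  apply: (cvg_within_notin (B := refl (2 * T) @^-1` `[0, T]%classic) _ nIt) => //.
  exact: closed_refl_itv.
have right s : `[0, T]%classic (refl (2 * T) s) ->
    refl_ext T c f s = c * f (refl (2 * T) s).
  rewrite /= in_itv/= /refl => /andP[? ?]; rewrite refl_ext_right//; lra.
rewrite right//; apply: cvg_trans (cvgM (cvg_cst c) (cvg_within_refl (cf _ It))).
by apply: fmap_within_eq => s; rewrite inE => /right ->.
Qed.

(** The inner derivative of the reflection turns [c] into [- c]. The condition on [f' T] says that
    the one-sided derivatives at [T] agree. *)
Lemma refl_ext_deriv (T c : R) (f f' : R -> R) : 0 <= T -> f T = c * f T ->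
  f' T = - c * f' T ->
  (forall t, `[0, T]%classic t -> deriv_within `[0, T]%classic f t (f' t)) ->
  forall t, `[0, 2 * T]%classic t ->
  deriv_within `[0, 2 * T]%classic (refl_ext T c f) t (refl_ext T (- c) f' t).
Proof.
move=> T0 fT f'T df t _; rewrite /deriv_within itv_reflU// setDUl.
apply: cvg_withinU.
  have [It|nIt] := pselect (`[0, T]%classic t); last first.
    apply: (cvg_within_notin (B := `[0, T]%classic) _ nIt) => //.
    exact: itv_closed.
  have left s : `[0, T]%classic s -> forall c f, refl_ext T c f s = f s.
    by rewrite /= in_itv/= => /andP[_ ?] ? ?; rewrite refl_ext_left.
  rewrite !left//; apply: cvg_trans (df _ It); apply: fmap_within_eq => s.
  by rewrite inE => -[? _]; rewrite left.
have [It|nIt] := pselect (`[0, T]%classic (refl (2 * T) t)); last first.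
  apply: (cvg_within_notin (B := refl (2 * T) @^-1` `[0, T]%classic) _ nIt) => //.
  exact: closed_refl_itv.
have right s : `[0, T]%classic (refl (2 * T) s) -> forall c f, f T = c * f T ->
    refl_ext T c f s = c * f (refl (2 * T) s).
  by rewrite /= in_itv/= /refl => /andP[? ?] ? ? ?; rewrite refl_ext_right//; lra.
rewrite !right//.
(* An involution is injective, so the punctured half is the preimage of a punctured interval, on
   which [df] applies. *)
have -> : (refl (2 * T) @^-1` `[0, T]) `\ t =
    refl (2 * T) @^-1` (`[0, T] `\ refl (2 * T) t).
  apply/seteqP; split => x /= [xI xt]; split => //; contra: xt.
    by move=> /(congr1 (refl (2 * T))); rewrite !reflK.
  by move=> ->.
apply: cvg_trans (cvgM (cvg_cst (- c)) (cvg_within_refl (df _ It))).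
apply: fmap_within_eq => s; rewrite inE => -[Is st] /=; rewrite right//.
have -> : refl (2 * T) s - refl (2 * T) t = - (s - t) by rewrite /refl; ring.
by rewrite invrN; ring.
Qed.

(** * Absolute continuity of combinations and extensions *)

Lemma abs_cont_on_lin (a b x y : R) (f g : R -> R) :
  abs_cont_on a b f -> abs_cont_on a b g ->
  abs_cont_on a b (fun t => x * f t + y * g t).
Proof.
move=> acf acg e e0.
(* The added 1 keeps the divisor positive when a coefficient is 0; each weighted sum then stays
   below [e / 2]. *)
have M0 (z : R) : 0 < 2 * (`|z| + 1) by have := normr_ge0 z; lra.
have [d1 d10 H1] := acf _ (divr_gt0 e0 (M0 x)).
have [d2 d20 H2] := acg _ (divr_gt0 e0 (M0 y)).
exists (Num.min d1 d2); first by rewrite lt_min d10.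
move=> N l r lr disj; rewrite lt_min.
move=> /andP[/(H1 N l r lr disj) S1 /(H2 N l r lr disj) S2].
apply: (@le_lt_trans _ _ (\sum_(i < N) (`|x| * `|f (r i) - f (l i)| +
    `|y| * `|g (r i) - g (l i)|))).
  apply: ler_sum => i _; rewrite -!normrM.
  apply: le_trans (ler_normD _ _); rewrite le_eqVlt; apply/orP; left; apply/eqP.
  by congr (`|_|); ring.
rewrite big_split/= -!mulr_sumr.
move: S1 S2; rewrite !ltr_pdivlMr ?M0//.
set S1 := \sum_(_ < _) _; set S2 := \sum_(_ < _) _ => h1 h2.
have : 0 <= S1 by apply: sumr_ge0.
have : 0 <= S2 by apply: sumr_ge0.
lra.
Qed.

Lemma refl_ext_abs_cont (T c : R) (f : R -> R) : 0 <= T -> f T = c * f T ->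
  abs_cont_on 0 T f -> abs_cont_on 0 (2 * T) (refl_ext T c f).
Proof.
move=> T0 fT acf e e0.
have M0 : 0 < 2 * (`|c| + 1) by have := normr_ge0 c; lra.
have e20 : 0 < e / 2 by lra.
have [d1 d10 H1] := acf _ e20.
have [d2 d20 H2] := acf _ (divr_gt0 e0 M0).
exists (Num.min d1 d2); first by rewrite lt_min d10.
move=> N l r lr disj; rewrite lt_min => /andP[s1 s2].
(* Clamping splits an interval straddling [T] into a part left of [T] and the
   reflection of its part right of [T]. *)
pose p := fun t : R => Num.min t T.
pose q := fun t : R => refl (2 * T) (Num.max t T).
(* On either side of [T] one clamp is frozen at [T]: on the left [c * f T] cancels [f T], on the
   right [f (p t)] does. *)
have extE t : refl_ext T c f t = f (p t) + (c * f (q t) - f T).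
  rewrite /p /q; case: (leP t T) => tT.
    rewrite refl_ext_left//.
    have -> : refl (2 * T) T = T by rewrite /refl; ring.
    by rewrite -fT; ring.
  by rewrite refl_ext_right ?ltW//; ring.
have Hp : \sum_(i < N) `|f (p (r i)) - f (p (l i))| < e / 2.
  apply: (H1 N (p \o l) (p \o r)).
  - move=> i /lr; rewrite /= /p; move: (l i) (r i) => x y [? [? ?]].
    by rewrite !minEle; do 2 case: ifP => ?; lra.
  - move=> i j iN jN ij; rewrite /= /p; move: (disj i j iN jN ij) => [h|h];
      [left|right]; rewrite !minEle; do 2 case: ifP => ?; lra.
  - apply: le_lt_trans s1; apply: ler_sum => i _; have := lr i (ltn_ord i).
    rewrite /= /p; move: (l i) (r i) => x y [? [? ?]].
    by rewrite !minEle; do 2 case: ifP => ?; lra.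
(* Since [q] reverses order, left and right endpoints trade places. *)
have Hq : \sum_(i < N) `|f (q (l i)) - f (q (r i))| < e / (2 * (`|c| + 1)).
  apply: (H2 N (q \o r) (q \o l)).
  - move=> i /lr; rewrite /= /q /refl; move: (l i) (r i) => x y [? [? ?]].
    by rewrite !maxEle; do 2 case: ifP => ?; lra.
  - move=> i j iN jN ij; rewrite /= /q /refl; move: (disj i j iN jN ij) => [h|h];
      [right|left]; rewrite !maxEle; do 2 case: ifP => ?; lra.
  - apply: le_lt_trans s2; apply: ler_sum => i _; have := lr i (ltn_ord i).
    rewrite /= /q /refl; move: (l i) (r i) => x y [? [? ?]].
    by rewrite !maxEle; do 2 case: ifP => ?; lra.
apply: (@le_lt_trans _ _ (\sum_(i < N) (`|f (p (r i)) - f (p (l i))| +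
    `|c| * `|f (q (l i)) - f (q (r i))|))).
  apply: ler_sum => i _; rewrite [X in _ + _ * X]distrC -normrM !extE.
  apply: le_trans (ler_normD _ _); rewrite le_eqVlt; apply/orP; left; apply/eqP.
  by congr (`|_|); ring.
rewrite big_split/= -!mulr_sumr.
move: Hp Hq; rewrite !ltr_pdivlMr ?M0//.
set S1 := \sum_(_ < _) _; set S2 := \sum_(_ < _) _ => h1 h2.
have : 0 <= S1 by apply: sumr_ge0.
have : 0 <= S2 by apply: sumr_ge0.
lra.
Qed.
End Reflection.

#[local] Instance ae_lebesgue_filter (R : realType) :
  Filter (nbhs (almost_everywhere (@lebesgue_measure R))).
Proof. exact: ae_filter_ringOfSetsType. Qed.

(** * Linear combinations and reflected extensions of solutions *)

Section Solve.
Context {R : realType}.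
Notation mu := (@lebesgue_measure R).

Implicit Types (a : nat -> R -> R) (u v sigma tau : R -> R).

Lemma solves_lin m (A B x y : R) a bc sigma tau u v :
  (forall D E, bc D -> bc E -> bc (fun k t => x * D k t + y * E k t)) ->
  solves m A B a bc sigma u -> solves m A B a bc tau v ->
  solves m A B a bc (fun t => x * sigma t + y * tau t)
    (fun t => x * u t + y * v t).
Proof.
move=> bc_lin [D [[Du [Dc [Dd Da]]] [bD eD]]] [E [[Ev [Ec [Ed Ea]]] [bE eE]]].
exists (fun k t => x * D k t + y * E k t); split; [split; [|split; [|split]]|split].
- by move=> t tAB; rewrite Du// Ev.
- move=> k km; apply/subspace_continuousP => t tAB.
  have /subspace_continuousP/(_ t tAB) cD := Dc k km.
  have /subspace_continuousP/(_ t tAB) cE := Ec k km.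
  exact: cvgD (cvgM (cvg_cst x) cD) (cvgM (cvg_cst y) cE).
- move=> k t km tAB.
  apply: cvg_trans (cvgD (cvgM (cvg_cst x) (Dd k t km tAB))
    (cvgM (cvg_cst y) (Ed k t km tAB))).
  by apply: fmap_within_eq => s _; rewrite !fctE /=; ring.
- exact: abs_cont_on_lin.
- exact: bc_lin.
apply: filterS2 eD eE => t hD hE tAB.
have [dD sD] := hD tAB; have [dE sE] := hE tAB.
have iD : is_derive t 1 (D m.-1) (derive1 (D m.-1) t).
  by split => //; rewrite derive1E.
have iE : is_derive t 1 (E m.-1) (derive1 (E m.-1) t).
  by split => //; rewrite derive1E.
have iDE := is_deriveD (is_deriveZ x iD) (is_deriveZ y iE).
split; first by case: iDE.
rewrite -sD -sE derive1E; case: iDE => _ /= ->.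
rewrite (eq_bigr (fun k : 'I_m => x * (a k t * D k t) + y * (a k t * E k t))).
  by rewrite big_split/= -!mulr_sumr /GRing.scale/=; ring.
by move=> k _; ring.
Qed.

(** Each differentiation flips the parity, so the k-th derivative extends with factor
    [s * (-1) ^+ k]; the second condition on [bc] is the matching at [T] for every order. The signs
    in [refl_coef] cancel these flips, and the top order is even, so the whole equation is
    multiplied by [s] on the right half. *)
Lemma solves_refl_ext n (T s : R) a bc sigma u :
  (0 < n)%N -> 0 < T ->
  (forall D, bc D -> forall k, (k < n)%N -> D k.*2 0 = 0) ->
  (forall D, bc D -> forall k, (k < n.*2)%N -> D k T = s * (-1) ^+ k * D k T) ->
  solves n.*2 0 T a bc sigma u ->
  solves n.*2 0 (2 * T) (refl_coef T a) (bc_D n 0 (2 * T))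
    (refl_ext T s sigma) (refl_ext T s u).
Proof.
move=> n0 T0 bc0 bcT [D [[Du [Dc [Dd Da]]] [bD eD]]].
have m0 : (n.*2.-1 < n.*2)%N by rewrite prednK// double_gt0.
have km k : (k <= n.*2.-1)%N -> (k < n.*2)%N by move=> /leq_ltn_trans; exact.
have T0' := ltW T0.
exists (fun k => refl_ext T (s * (-1) ^+ k) (D k)).
split; [split; [|split; [|split]]|split].
- move=> t; rewrite itv_reflU// expr0 mulr1 => -[] /= tI.
    have tT : t <= T by move: tI; rewrite in_itv/= => /andP[].
    by rewrite !refl_ext_left//; exact: Du.
  rewrite /refl_ext; case: ifP => tT; last by rewrite Du.
  rewrite Du//= in_itv/= tT andbT.
  by move: tI; rewrite in_itv/= /refl => /andP[]; lra.
- by move=> k kn; apply: refl_ext_continuous => //; [exact: bcT (km k kn)|exact: Dc].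
- move=> k t kn tJ.
  have := @refl_ext_deriv _ T (s * (-1) ^+ k) (D k) (D k.+1).
  have -> : - (s * (-1) ^+ k) = s * (-1) ^+ k.+1 by rewrite exprS; ring.
  apply => // [||t']; [exact: bcT (km _ (ltnW kn))|exact: bcT (km _ kn)|exact: Dd].
- by apply: refl_ext_abs_cont => //; exact: bcT.
- move=> k kn; rewrite refl_ext_left// bc0//; split => //.
  rewrite /refl_ext ifF; last by apply/negbTE; rewrite -ltNge; lra.
  by rewrite /refl subrr bc0// mulr0.
(* The equation is given only on the open interval, so it says nothing at [T], a null set. *)
have tT : {ae mu, forall t, t != T}.
  exists [set T]; split => //; first exact: lebesgue_measure_set1.
  by move=> t /= /negP; rewrite negbK => /eqP.
apply: filterS3 tT eD (ae_refl (2 * T) eD) => t tT hD hD' /=.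
rewrite in_itv/= => /andP[t0 t2].
(* The last entry of the tower has odd index, hence the opposite sign. *)
have sgnE : s * (-1) ^+ n.*2.-1 = - s.
  have : s * (-1) ^+ n.*2 = s by rewrite -mul2n exprM sqrrN !expr1n mulr1.
  rewrite -{1}(prednK (n := n.*2)) ?double_gt0// exprS => h.
  by rewrite -[in RHS]h; ring.
case: (ltP t T) => [tT'|]; last first.
  rewrite le_eqVlt eq_sym (negbTE tT)/= => tT'.
  have tI : `]0, T[%classic (refl (2 * T) t).
    by rewrite /= in_itv/= /refl; apply/andP; split; lra.
  have [dD sD] := hD' tI.
  have iD : is_derive (refl (2 * T) t) 1 (D n.*2.-1)
      (derive1 (D n.*2.-1) (refl (2 * T) t)).
    by split => //; rewrite derive1E.
  have ir : is_derive t 1 (refl (2 * T)) (- 1).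
    have -> : refl (2 * T) = cst (2 * T) - id by apply/funext => x.
    by apply: is_derive_eq; rewrite sub0r.
  have iDr := is_deriveZ (- s) (is_derive1_comp iD ir).
  (* Being right of [T] is an open condition, so a single branch describes the extension near [t]
     and its derivative carries over. *)
  have near_t : \near t, (- s *: (D n.*2.-1 \o refl (2 * T))) t =
      refl_ext T (s * (-1) ^+ n.*2.-1) (D n.*2.-1) t.
    near=> x; rewrite /refl_ext ifF ?sgnE//; apply/negbTE; rewrite -ltNge.
    by near: x; exact: lt_nbhsr.
  have iE := near_eq_is_derive near_t iDr.
  split; first by case: iE.
  rewrite derive1E; case: iE => _ /= ->.
  rewrite /refl_ext leNgt tT'/= -sD mulrDr; congr (_ + _).
    by rewrite /GRing.scale/=; ring.
  rewrite mulr_sumr; apply: eq_bigr => k _.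
  (* The coefficient and the derivative both carry [(-1) ^+ k]; the product leaves only [s]. *)
  rewrite /refl_coef leNgt tT'/= -/(refl (2 * T) t).
  rewrite -signr_odd; case: (odd k); rewrite ?expr0 ?expr1; ring.
have [|dD sD] := hD; first by rewrite /= in_itv/= t0.
have iD : is_derive t 1 (D n.*2.-1) (derive1 (D n.*2.-1) t).
  by split => //; rewrite derive1E.
have near_t : \near t, D n.*2.-1 t =
    refl_ext T (s * (-1) ^+ n.*2.-1) (D n.*2.-1) t.
  near=> x; rewrite refl_ext_left//; apply: ltW.
  by near: x; exact: lt_nbhsl.
have iE := near_eq_is_derive near_t iD.
split; first by case: iE.
rewrite derive1E; case: iE => _ /= ->.
rewrite [RHS]refl_ext_left ?ltW// -sD; congr (_ + _).
by apply: eq_bigr => k _; rewrite refl_ext_left ?ltW// /refl_coef ltW.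
Unshelve. all: by end_near. Qed.

(** * Green's integrals and their sign *)

Lemma green_solution m (A B : R) a bc (G : R -> R -> R) sigma u :
  (forall (x y : R) D E, bc D -> bc E -> bc (fun k t => x * D k t + y * E k t)) ->
  is_green m A B a bc G ->
  mu.-integrable `[A, B]%classic (EFin \o sigma) ->
  solves m A B a bc sigma u ->
  forall t, `[A, B]%classic t ->
  u t = Rintegral mu `[A, B]%classic (fun s => G t s * sigma s).
Proof.
move=> bc_lin [nr Gs] si us t tAB; have [_ vs] := Gs _ si.
(* The difference of [u] and the Green's integral solves the homogeneous problem, so it vanishes by
   nonresonance. *)
have := solves_lin (bc_lin 1 (- 1)) us vs.
under eq_fun do rewrite mul1r mulN1r subrr.
by move=> /nr/(_ t tAB)/eqP; rewrite mul1r mulN1r subr_eq0 => /eqP.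
Qed.

(** The integrand agrees almost everywhere with its absolute value. *)
Lemma Rintegral_ae_ge0 (A : set R) (f : R -> R) : measurable A ->
  mu.-integrable A (EFin \o f) -> {ae mu, forall t, A t -> 0 <= f t} ->
  0 <= Rintegral mu A f.
Proof.
move=> mA fi f0; rewrite /Rintegral.
have mf := measurable_int _ fi.
rewrite (_ : \int[mu]_(x in A) (f x)%:E = \int[mu]_(x in A) `|(f x)%:E|)%E.
  by apply: fine_ge0; exact: integral_ge0.
apply: ae_eq_integral => //; first exact: measurableT_comp.
by apply: filterS f0 => t h /h ft; rewrite /= ger0_norm.
Qed.

Lemma green_sign m (A B e : R) a bc (G : R -> R -> R) sigma u :
  (forall (x y : R) D E, bc D -> bc E -> bc (fun k t => x * D k t + y * E k t)) ->
  is_green m A B a bc G ->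
  (forall t s, `[A, B]%classic t -> `[A, B]%classic s -> 0 <= e * G t s) ->
  mu.-integrable `[A, B]%classic (EFin \o sigma) ->
  {ae mu, forall t, `[A, B]%classic t -> 0 <= sigma t} ->
  solves m A B a bc sigma u ->
  forall t, `[A, B]%classic t -> 0 <= e * u t.
Proof.
move=> bc_lin GG eG si s0 us t tAB; rewrite (green_solution bc_lin GG si us tAB).
have [_ /(_ _ si)[/(_ t tAB) Gi _]] := GG.
rewrite -RintegralZl//; apply: Rintegral_ae_ge0 => //.
  suff : mu.-integrable `[A, B]%classic (fun s => e%:E * (G t s * sigma s)%:E)%E.
    by apply: eq_integrable.
  exact: integrableZl.
apply: filterS s0 => s h sAB; rewrite mulrA; apply: mulr_ge0; [exact: eG|exact: h].
Qed.

(** Here [e] is the sign of [G] and [e'] the sign for which [e' * sigma1] dominates; carrying both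
    treats the three cases of the theorem at once. *)
Lemma green_comparison n (T e e' : R) a (G : R -> R -> R) sigma1 sigma2 u1 u2 :
  (0 < n)%N -> 0 < T -> `|e| = 1 ->
  is_green n.*2 0 (2 * T) (refl_coef T a) (bc_D n 0 (2 * T)) G ->
  mu.-integrable `[0, T]%classic (EFin \o sigma1) ->
  mu.-integrable `[0, T]%classic (EFin \o sigma2) ->
  solves n.*2 0 T a (bc_M2 n 0 T) sigma1 u1 ->
  solves n.*2 0 T a (bc_D n 0 T) sigma2 u2 ->
  (forall t s, `[0, 2 * T]%classic t -> `[0, 2 * T]%classic s -> 0 <= e * G t s) ->
  {ae mu, forall t, `[0, T]%classic t -> `|sigma2 t| <= e' * sigma1 t} ->
  forall t, `[0, T]%classic t -> `|u2 t| <= e * e' * u1 t.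
Proof.
move=> n0 T0 e1 GG si1 si2 us1 us2 eG s12 t tI.
have bc_lin (x y : R) D E : bc_D n 0 (2 * T) D -> bc_D n 0 (2 * T) E ->
    bc_D n 0 (2 * T) (fun k t => x * D k t + y * E k t).
  move=> bD bE k kn; have [-> ->] := bD k kn; have [-> ->] := bE k kn.
  by rewrite !mulr0 addr0.
have v1s : solves n.*2 0 (2 * T) (refl_coef T a) (bc_D n 0 (2 * T))
    (refl_ext T 1 sigma1) (refl_ext T 1 u1).
  apply: solves_refl_ext us1 => // D bD k kn; first by have [] := bD k kn.
  (* For the even extension, matching is automatic at even orders and the mixed conditions kill the
     odd ones at [T]. *)
  rewrite mul1r -signr_odd; have [ok|] := boolP (odd k); last by rewrite expr0 mul1r.
  have -> : D k T = 0; last by rewrite mulr0.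
  have kn2 : (k./2 < n)%N by rewrite ltn_half_double.
  have [_] := bD _ kn2.
  by rewrite -[in D k T](odd_double_half k) ok add1n.
have v2s : solves n.*2 0 (2 * T) (refl_coef T a) (bc_D n 0 (2 * T))
    (refl_ext T (- 1) sigma2) (refl_ext T (- 1) u2).
  apply: solves_refl_ext us2 => // D bD k kn; first by have [] := bD k kn.
  (* For the odd extension the roles swap: the Dirichlet conditions kill the even orders at [T]. *)
  rewrite -signr_odd; have [ok|ok] := boolP (odd k); first by rewrite expr1 mulrNN !mul1r.
  have -> : D k T = 0; last by rewrite mulr0.
  have kn2 : (k./2 < n)%N by rewrite ltn_half_double.
  have [_] := bD _ kn2.
  by rewrite even_halfK.
have ext_ge0 y : `|y| = 1 -> {ae mu, forall t, `[0, 2 * T]%classic t ->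
    0 <= e' * refl_ext T 1 sigma1 t + y * refl_ext T (- 1) sigma2 t}.
  move=> y1; apply: filterS2 s12 (ae_refl (2 * T) s12) => x h h'.
  have bound z w : `|z| = 1 -> `|sigma2 w| <= e' * sigma1 w ->
      0 <= e' * sigma1 w + z * sigma2 w.
    move=> z1 hw; have : `|z * sigma2 w| <= e' * sigma1 w by rewrite normrM z1 mul1r.
    by rewrite ler_norml => /andP[]; lra.
  rewrite /= in_itv/= => /andP[x0 x2].
  rewrite /refl_ext; case: ifP => xT.
    by apply: bound => //; apply: h; rewrite /= in_itv/= x0.
  (* The odd extension only replaces [y] by [- y] here, again of modulus 1. *)
  rewrite mul1r mulrA; apply: bound; first by rewrite normrM y1 normrN1 mul1r.
  apply: h'; rewrite /= in_itv/= /refl; move/negbT: xT; rewrite -ltNge => xT.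
  by apply/andP; split; lra.
have main y : `|y| = 1 -> 0 <= e * (e' * u1 t + y * u2 t).
  move=> y1.
  have tT : t <= T by move: tI; rewrite /= in_itv/= => /andP[].
  have := green_sign bc_lin GG eG _ (ext_ge0 y y1) (solves_lin (bc_lin e' y) v1s v2s).
  move=> /(_ _ t); rewrite !refl_ext_left//; apply.
    suff : mu.-integrable `[0, 2 * T]%classic
        (fun s => e'%:E * (refl_ext T 1 sigma1 s)%:E +
                  y%:E * (refl_ext T (- 1) sigma2 s)%:E)%E.
      by apply: eq_integrable.
    by apply: integrableD => //; apply: integrableZl => //;
      exact: integrable_refl_ext.
  by move: tI; rewrite /= !in_itv/= => /andP[-> ?]; lra.
(* The two signs of [y] bound [e * u2 t] on both sides, and [e] has modulus 1. *)
have := main 1 (normr1 _); have := main (- 1) (normrN1 _).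
have -> : `|u2 t| = `|e * u2 t| by rewrite normrM e1 mul1r.
rewrite mul1r mulN1r mulrBr mulrDr mulrA ler_norml => h1 h2.
by apply/andP; split; lra.
Qed.

End Solve.

Theorem theorem6p5 (R : realType) (n : nat) (T : R) (alpha : \bar R)
    (a : nat -> R -> R)
    (GD2T GDT GM2T : R -> R -> R) (sigma1 sigma2 uM2 uD : R -> R) :
  (1 <= n)%N -> 0 < T -> (1 <= alpha)%E ->
  (forall k, (k < n.*2)%N -> in_Lp alpha `[0, T]%classic (a k)) ->
  is_green n.*2 0 (2 * T) (refl_coef T a) (bc_D n 0 (2 * T)) GD2T ->
  is_green n.*2 0 T a (bc_D n 0 T) GDT ->
  is_green n.*2 0 T a (bc_M2 n 0 T) GM2T ->
  (@lebesgue_measure R).-integrable `[0, T]%classic (EFin \o sigma1) ->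
  (@lebesgue_measure R).-integrable `[0, T]%classic (EFin \o sigma2) ->
  solves n.*2 0 T a (bc_M2 n 0 T) sigma1 uM2 ->
  solves n.*2 0 T a (bc_D n 0 T) sigma2 uD ->
  [/\
   (forall t s, `[0, 2 * T]%classic t -> `[0, 2 * T]%classic s -> 0 <= GD2T t s) ->
     {ae @lebesgue_measure R, forall t, `[0, T]%classic t -> `|sigma2 t| <= sigma1 t} ->
     forall t, `[0, T]%classic t -> `|uD t| <= uM2 t,
   (forall t s, `[0, 2 * T]%classic t -> `[0, 2 * T]%classic s -> GD2T t s <= 0) ->
     {ae @lebesgue_measure R, forall t, `[0, T]%classic t -> 0 <= sigma2 t <= sigma1 t} ->
     forall t, `[0, T]%classic t -> uM2 t <= 0 /\ uM2 t <= uD t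
  & (forall t s, `[0, 2 * T]%classic t -> `[0, 2 * T]%classic s -> GD2T t s <= 0) ->
     {ae @lebesgue_measure R, forall t, `[0, T]%classic t -> sigma1 t <= sigma2 t <= 0} ->
     forall t, `[0, T]%classic t -> 0 <= uM2 t /\ uD t <= uM2 t].
Proof.
move=> n0 T0 _ _ GG _ _ si1 si2 us1 us2.
have cmp e e' e1 := @green_comparison R n T e e' a GD2T sigma1 sigma2 uM2 uD
  n0 T0 e1 GG si1 si2 us1 us2.
split => G0 s12 t tI.
- rewrite -[uM2 t]mul1r -[X in X * uM2 t]mul1r; apply: cmp => //.
  + exact: normr1.
  + by move=> ? ? ? ?; rewrite mul1r G0.
  + by apply: filterS s12 => x h /h; rewrite mul1r.
(* The bound by [- uM2 t] forces [uM2 t] to be nonpositive and also bounds [uD t] from below. *)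
- have : `|uD t| <= - 1 * 1 * uM2 t.
    apply: cmp => //; first exact: normrN1.
    + by move=> x y xJ yJ; have := G0 x y xJ yJ; lra.
    + by apply: filterS s12 => x h /h /andP[h0 h1]; rewrite mul1r ger0_norm.
  by have := ler_norm (- uD t); have := normr_ge0 (uD t); rewrite normrN; lra.
(* Both signs are negative: [- sigma1] dominates, and the product of the signs is 1. *)
- have : `|uD t| <= - 1 * (- 1) * uM2 t.
    apply: cmp => //; first exact: normrN1.
    + by move=> x y xJ yJ; have := G0 x y xJ yJ; lra.
    + by apply: filterS s12 => x h /h /andP[h0 h1]; rewrite ler0_norm//; lra.
  by have := ler_norm (uD t); have := normr_ge0 (uD t); lra.
Qed.
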